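(* Let $K$ be a compact subset of $\mathbb{R}$, let $[a,b]$ be a closed and bounded interval containing $K$, and let $K^c=[a,b]\setminus K$. Then the normed spaces $$\left\{L_\alpha\in\mathcal{C}[a,b]^*_+ : \alpha \text{ is constant in } K^c\right\}\quad\text{and}\quad \mathcal{C}(K)^*_+$$ are isomorphic.
   Context: For a compact set $X\subset\mathbb{R}$, $\mathcal{C}(X)$ is the real vector space of continuous functions $f:X\to\mathbb{R}$ with the uniform norm $\|f\|_\infty=\sup_{x\in X}|f(x)|$; $\mathcal{C}[a,b]$ is the case $X=[a,b]$. $\mathcal{C}(X)^*_+$ denotes the set of positive linear functionals on $\mathcal{C}(X)$, i.e. linear $L:\mathcal{C}(X)\to\mathbb{R}$ with $L(f)\ge 0$ whenever $f(x)\ge 0$ for every $x\in X$. The norm of a functional is $\|L\|=\sup\{|L(f)|: f\in\mathcal{C}(X),\ \|f\|_\infty\le 1\}$. A function $\alpha:[a,b]\to\mathbb{R}$ is normalized if $\alpha(a)=0$ and $\alpha$ is continuous from the right at every $t$ with $a<t<b$ (not necessarily at $a$). By F. Riesz's theorem, for each positive linear functional $L$ on $\mathcal{C}[a,b]$ there is a unique normalized monotone (nondecreasing) function $\alpha:[a,b]\to\mathbb{R}$ such that $Lf=\int_a^b f(x)\,d\alpha(x)$ for every $f\in\mathcal{C}[a,b]$, the integral being a Riemann–Stieltjes integral; $L_\alpha$ denotes the functional with corresponding monotone function $\alpha$. The monotone function $\alpha$ is said to be constant in $K^c$ if it is constant in each interval of $K^c$. A transformation $T$ which preserves the norm, $\|Tx\|=\|x\|$,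 is called an isometry. Two normed vector spaces $X$ and $Y$ are said to be isomorphic if there is a linear, bijective isometry $T:X\to Y$. *)

(* Defs.v *)
From HB Require Import structures.
From mathcomp Require Import all_boot all_order all_algebra.
From mathcomp Require Import all_classical all_reals all_analysis.

Set Implicit Arguments.
Unset Strict Implicit.
Unset Printing Implicit Defensive.

Import Order.TTheory GRing.Theory Num.Theory.
Import numFieldNormedType.Exports.

Local Open Scope classical_set_scope.
Local Open Scope ring_scope.

(* The pointwise vector space structure on the continuous functions X -> R. *)
Section ContinuousLmodule.
Context {R : realType} {X : topologicalType}.
Implicit Types f g h : continuousType X R.

Fact cts_zero_subproof : continuous ((fun=> 0) : X -> R).
Proof. by move=> x; exact: cvg_cst. Qed.

Fact cts_opp_subproof f : continuous (fun x => - f x).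
Proof. by move=> x; apply: cvgN; exact: cts_fun. Qed.

Fact cts_add_subproof f g : continuous (fun x => f x + g x).
Proof. by move=> x; apply: cvgD; exact: cts_fun. Qed.

Fact cts_scale_subproof (c : R) f : continuous (fun x => c * f x).
Proof. by move=> x; apply: cvgMr; exact: cts_fun. Qed.

Definition cts_zero : continuousType X R := mkcts cts_zero_subproof.
Definition cts_opp f : continuousType X R := mkcts (@cts_opp_subproof f).
Definition cts_add f g : continuousType X R := mkcts (@cts_add_subproof f g).
Definition cts_scale (c : R) f : continuousType X R :=
  mkcts (@cts_scale_subproof c f).

Fact cts_addA : associative cts_add.
Proof. by move=> f g h; apply/continuousEP => x; exact: addrA. Qed.

Fact cts_addC : commutative cts_add.
Proof. by move=> f g; apply/continuousEP => x; exact: addrC. Qed.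

Fact cts_add0 : left_id cts_zero cts_add.
Proof. by move=> f; apply/continuousEP => x; exact: add0r. Qed.

Fact cts_addN : left_inverse cts_zero cts_opp cts_add.
Proof. by move=> f; apply/continuousEP => x; exact: addNr. Qed.

HB.instance Definition _ := GRing.isZmodule.Build (continuousType X R)
  cts_addA cts_addC cts_add0 cts_addN.

Fact cts_scaleA c d f : cts_scale c (cts_scale d f) = cts_scale (c * d) f.
Proof. by apply/continuousEP => x; exact: mulrA. Qed.

Fact cts_scale1 : left_id 1 cts_scale.
Proof. by move=> f; apply/continuousEP => x; exact: mul1r. Qed.

Fact cts_scaleDr : right_distributive cts_scale +%R.
Proof. by move=> c f g; apply/continuousEP => x; exact: mulrDr. Qed.

Fact cts_scaleDl f : {morph cts_scale^~ f : c d / c + d}.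
Proof. by move=> c d; apply/continuousEP => x; exact: mulrDl. Qed.

HB.instance Definition _ := GRing.Zmodule_isLmodule.Build R (continuousType X R)
  cts_scaleA cts_scale1 cts_scaleDr cts_scaleDl.

End ContinuousLmodule.

Section Functionals.
Context {R : realType}.
Implicit Type X : set R.
Local Notation C X := (continuousType (set_type X) R).

(* [sup] is 0 on the empty set, so this is 0 when X is empty *)
Definition sup_norm X (f : C X) : R := sup (range (fun x => `|f x|)).

Definition dual_norm X (L : C X -> R) : R :=
  sup [set `|L f| | f in [set f | sup_norm f <= 1]].

Definition positive_functionals X : set (C X -> R) :=
  [set L | scalar L /\ forall f : C X, (forall x, 0 <= f x) -> 0 <= L f].

End Functionals.

(* Sets of positive functionals are not vector spaces but convex cones:
   linearity is understood for the combinations available in a cone. *)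
Section Cones.
Context {R : realType}.

Definition convex_cone (V : lmodType R) (A : set V) : Prop :=
  A 0 /\ forall (c d : R) (u v : V),
    0 <= c -> 0 <= d -> A u -> A v -> A (c *: u + d *: v).

Definition isomorphic_normed_cones (V W : lmodType R)
    (normV : V -> R) (normW : W -> R) (A : set V) (B : set W) : Prop :=
  [/\ convex_cone A, convex_cone B & exists T : V -> W,
    [/\ set_bij A B T,
        forall (c d : R) (u v : V), 0 <= c -> 0 <= d -> A u -> A v ->
          T (c *: u + d *: v) = c *: T u + d *: T v
      & forall u, A u -> normW (T u) = normV u]].

End Cones.

Section RiemannStieltjes.
Context {R : realType} (a b : R).
Implicit Types (alpha : R -> R) (K : set R).
Local Notation C X := (continuousType (set_type X) R).

(* The functions alpha : [a, b] -> R are rendered as functions R -> R whose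
   values outside [a, b] are never used. The partition
   a = x_0 < x_1 < ... < x_n = b is given by s = [:: x_1; ...; x_n]. *)
Definition RS_sum (f : C `[a, b]) alpha (s : seq R)
    (t : nat -> `[a, b]%classic) : R :=
  \sum_(0 <= i < size s)
    f (t i) * (alpha (nth b (a :: s) i.+1) - alpha (nth b (a :: s) i)).

Definition is_RS_integral (f : C `[a, b]) alpha (I : R) : Prop :=
  forall e : R, 0 < e -> exists2 d : R, 0 < d &
    forall (s : seq R) (t : nat -> `[a, b]%classic),
      itv_partition a b s ->
      (forall i, (i < size s)%N ->
        nth b (a :: s) i <= \val (t i) <= nth b (a :: s) i.+1) ->
      (forall i, (i < size s)%N ->
        nth b (a :: s) i.+1 - nth b (a :: s) i < d) ->
      `|RS_sum f alpha s t - I| < e.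

Definition normalized alpha : Prop :=
  alpha a = 0 /\
  forall t, a < t < b -> alpha x @[x --> t^'+] --> alpha t.

Definition monotone_itv alpha : Prop := {in `[a, b] &, nondecreasing_fun alpha}.

Definition constant_in_compl K alpha : Prop :=
  forall I : interval R, [set` I] `<=` `[a, b] `\` K ->
    {in I &, forall x y, alpha x = alpha y}.

Definition RS_functionals_constant_in_compl K : set (C `[a, b] -> R) :=
  [set L | positive_functionals L /\
    exists alpha, [/\ normalized alpha, monotone_itv alpha,
      forall f, is_RS_integral f alpha (L f) & constant_in_compl K alpha]].

End RiemannStieltjes.

Arguments positive_functionals {R} X.
Arguments RS_functionals_constant_in_compl {R} a b K.

(* Main.v *)
Require Import Defs.
From HB Require Import structures.
From mathcomp Require Import all_boot all_order all_algebra.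
From mathcomp Require Import all_classical all_reals all_analysis.
From mathcomp Require Import ring lra.
Import Order.TTheory GRing.Theory Num.Theory.
Import numFieldNormedType.Exports.

Local Open Scope classical_set_scope.
Local Open Scope ring_scope.

(** Why the theorem is true.  A functional [L] in the left-hand cone is
integration against [d alpha], and [alpha] being constant off [K] means that
this mass sits on [K]; so [L h] depends only on the values of [h] on [K]
([RS_integral_vanish]: in a fine Riemann-Stieltjes sum, an interval that misses
[K] has increment zero, and on an interval that meets [K] a function vanishing
on [K] is small).  Every continuous function on [K] or on [[a, b]] is the
restriction of one on the whole line ([restriction_surj], by Tietze), hence
[L] descends to a functional [T L] on [C(K)], namely [T L] of [h] restricted to
[K] is [L] of [h] restricted to [[a, b]].  [T] is injective because the
restrictions of [h] exhaust [C[a, b]].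

Surjectivity is Riesz's representation theorem with control of the support.
Given a positive [M] on [C(K)], put [alpha t] (here [distr]) for the infimum of
[M] over continuous functions which are [1] up to [t] and then drop linearly to
[0] with slope [-n].  These functions decrease in [n], so [alpha t] is also a
limit.  For a fine partition, [h] is uniformly close to the combination of
differences of such functions weighted by the values of [h] at the tags
([step_sum_close]); applying [M] and letting [n] grow gives the
Riemann-Stieltjes sum, so [M h] is the integral of [h] against [alpha]
([distr_RS_integral]).  Along an interval that misses [K], the functions that
define [alpha] eventually coincide on [K], whence constancy.

Finally [T] preserves the norm because the norm of a positive functional is its
value at the constant [1] ([dual_norm_positive]), and [T] does not change that
value. *)

(** * Restrictions of continuous functions on the line *)

Section Restriction.
Context {R : realType}.
Implicit Types (X : set R) (h : continuousType R R).

Fact restriction_subproof X h : continuous (fun x : X => h (\val x)).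
Proof.
move=> x; apply: (@continuous_comp X R R set_val h).
  exact: initial_continuous.
exact: cts_fun.
Qed.

(** Working with restrictions from the whole line makes the passage between
[C(K)] and [C[a, b]] a matter of comparing values, with no inclusion map
between the two subtypes. *)
Definition restriction X h : continuousType (set_type X) R :=
  mkcts (restriction_subproof X h).

Definition cts_const (c : R) : continuousType R R :=
  mkcts ((fun x => cvg_cst c) : continuous (fun _ : R => c)).

Lemma restriction_eq X h1 h2 :
  (forall x, X x -> h1 x = h2 x) -> restriction X h1 = restriction X h2.
Proof. by move=> h12; apply/continuousEP => x; apply: h12; exact: set_valP. Qed.

Lemma eq_restriction {X h1 h2 x} : restriction X h1 = restriction X h2 ->
  X x -> h1 x = h2 x.
Proof. by move=> /continuousEP h12 Xx; exact: (h12 (SigSub (mem_set Xx))). Qed.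

Lemma cts_bounded X (f : continuousType (set_type X) R) : compact X ->
  exists2 M : R, 0 < M & forall x, `|f x| <= M.
Proof.
move=> cX.
have cf : {within X, continuous (valL_ 0 f)}.
  by apply/subspace_valL_continuousP'; exact: cts_fun.
have := compact_bounded (continuous_compact cf cX) => -[M [_ bM]].
exists (`|M| + 1); first by rewrite ltr_wpDl.
move=> x; have -> : f x = valL_ 0 f (\val x).
  by have /(congr1 (@^~ x)) /= := @valLK _ _ 0 X f.
apply: (bM (`|M| + 1)); first by rewrite (le_lt_trans (ler_norm M))// ltrDl.
by exists (\val x) => //; exact: set_valP.
Qed.

(** Tietze's theorem; compactness gives both the closedness and the bound that
the bounded form of the theorem asks for. *)
Lemma restriction_surj X (g : continuousType (set_type X) R) : compact X ->
  exists h, restriction X h = g.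
Proof.
move=> cX; have [M M0 bM] := cts_bounded X g cX.
have cf : {within X, continuous (valL_ 0 g : R -> R^o)}.
  by apply/subspace_valL_continuousP'; exact: cts_fun.
have gE (x : X) : valL_ 0 g (\val x) = g x.
  by have /(congr1 (@^~ x)) /= := @valLK _ _ 0 X g.
have bf x : X x -> `|valL_ 0 g x| <= M.
  by move=> Xx; rewrite (gE (SigSub (mem_set Xx))).
have [h [hg ch _]] := continuous_bounded_extension
  (@pseudometric_normal R R) (compact_closed (@Rhausdorff R) cX) M0 cf bf.
exists (mkcts ch); apply/continuousEP => x.
by rewrite -gE /= /mkcts -hg//; apply/mem_set; exact: set_valP.
Qed.

Lemma restrictionD X h1 h2 :
  restriction X (h1 + h2) = restriction X h1 + restriction X h2.
Proof. exact/continuousEP. Qed.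

Lemma restrictionZ X (c : R) h :
  restriction X (c *: h) = c *: restriction X h.
Proof. exact/continuousEP. Qed.

Lemma cts_sumE (T : topologicalType) (I : Type) (r : seq I)
    (F : I -> continuousType T R) (x : T) :
  (\sum_(i <- r) F i) x = \sum_(i <- r) F i x.
Proof. by elim/big_rec2: _ => //= i y1 y2 _ <-. Qed.

(** Heine-Cantor.  Near each [x] of [X] some radius works, with room to spare
for all nearby points; compactness, as a near-covering property, provides one
radius for all points. *)
Lemma heine_cantor X h (e : R) : compact X -> 0 < e ->
  exists2 d : R, 0 < d &
    forall x y, X x -> X y -> `|x - y| < d -> `|h x - h y| < e.
Proof.
move=> /compact_near_coveringP cX e0.
have [d /= d0 dP] : \forall d \near (0 : R)^'+, X `<=`
    [set x | forall y, X y -> `|x - y| < d -> `|h x - h y| < e].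
  apply: (cX _ _ (fun d x => forall y, X y -> `|x - y| < d -> `|h x - h y| < e)).
  move=> x Xx.
  have /cvgrPdist_lt /(_ (e / 2)) := @cts_fun _ _ h x.
  rewrite divr_gt0// => /(_ isT) [r /= r0 rP].
  have r20 : 0 < r / 2 by rewrite divr_gt0.
  exists (ball x (r / 2), [set d | d < r / 2]).
    by split; [exact: nbhsx_ballx|exact: nbhs_right_lt].
  move=> [z d] [/= xz dr] y Xy zy.
  have := rP z; have := rP y; rewrite /ball/= in xz *.
  have xy : `|x - y| < r.
    rewrite (splitr r) (le_lt_trans (ler_distD z _ _))// ltrD//.
    exact: lt_trans zy dr.
  have xz' : `|x - z| < r by rewrite (lt_trans xz)// gtr_pMr// invf_lt1 ?ltr1n.
  move=> /(_ xy) hy /(_ xz') hz.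
  by rewrite (splitr e) (le_lt_trans (ler_distD (h x) _ _))// ltrD// distrC.
exists (d / 2); first by rewrite divr_gt0.
move=> x y Xx Xy xy; apply: (dP (d / 2)) => //=.
  by rewrite sub0r normrN gtr0_norm ?divr_gt0// gtr_pMr// invf_lt1 ?ltr1n.
by rewrite divr_gt0.
Qed.

End Restriction.

(** * Positive functionals and their norm *)

Section PositiveFunctionals.
Context {R : realType} {X : set R}.
Local Notation C := (continuousType (set_type X) R).
Implicit Types (L : C -> R) (f g : C).

Definition scalar_bundle L (linL : scalar L) : {scalar C} :=
  HB.pack L (GRing.isLinear.Build R C R *%R L linL).

(** The additivity and homogeneity lemmas are stated for bundled linear maps;
replacing [L] by [L'] gives access to them. *)
Lemma positive_linear L : positive_functionals X L ->
  exists L' : {scalar C}, L = L'.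
Proof. by move=> [linL _]; exists (scalar_bundle L linL). Qed.

Lemma positive_le L f g : positive_functionals X L ->
  (forall x, f x <= g x) -> L f <= L g.
Proof.
move=> LX fg; have [L' LE] := positive_linear L LX.
rewrite -subr_ge0 LE -linearB -LE; apply: LX.2 => x.
by rewrite -[_ x]/(g x - f x) subr_ge0.
Qed.

Local Notation one := (restriction X (cts_const 1)).

Lemma positive_norm_le L f (c : R) : positive_functionals X L ->
  (forall x, `|f x| <= c) -> `|L f| <= c * L one.
Proof.
move=> LX fc; have [L' LE] := positive_linear L LX.
have cE : c * L one = L (c *: one) by rewrite LE linearZ.
rewrite ler_norml cE; apply/andP; split; last first.
  apply: positive_le => // x; rewrite -[leRHS]/(c * 1) mulr1.
  exact: le_trans (ler_norm _) (fc x).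
rewrite LE -linearN -LE; apply: positive_le => // x.
rewrite -[leLHS]/(- (c * 1)) mulr1 lerNl.
by rewrite (le_trans _ (fc x))// -normrN ler_norm.
Qed.

Lemma positive_one L : positive_functionals X L -> 0 <= L one.
Proof. by move=> LX; apply: LX.2 => x; exact: ler01. Qed.

Lemma sup_norm_le f (c : R) : 0 <= c -> (forall x, `|f x| <= c) ->
  sup_norm f <= c.
Proof.
move=> c0 fc; rewrite /sup_norm.
have [r0|/set0P/negP/negPn/eqP ->] := pselect (range (fun x => `|f x|) !=set0).
  by apply: ge_sup => // _ [y _ <-].
by rewrite sup0.
Qed.

Lemma le_sup_norm f x : compact X -> `|f x| <= sup_norm f.
Proof.
move=> cX; apply: ub_le_sup; last by exists x.
by have [M _ bM] := cts_bounded X f cX; exists M => _ [y _ <-].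
Qed.

(** The constant [1] is the largest function of norm at most [1], so it attains
the supremum.  This covers the empty [X] too: there [1 = 0], and both sides
vanish. *)
Lemma dual_norm_positive L : compact X -> positive_functionals X L ->
  dual_norm L = L one.
Proof.
move=> cX LX.
have ub : ubound [set `|L f| | f in [set f | sup_norm f <= 1]] (L one).
  move=> _ [f /= f1 <-]; rewrite -[leRHS]mul1r.
  by apply: positive_norm_le => // x; exact: le_trans (le_sup_norm f x cX) f1.
have Lone : [set `|L f| | f in [set f | sup_norm f <= 1]] (L one).
  exists one; last by rewrite ger0_norm// positive_one.
  by apply: sup_norm_le => // x; rewrite -[one x]/1 normr1.
apply/eqP; rewrite eq_le ge_sup//=; last by exists (L one).
by apply: ub_le_sup => //; exists (L one).
Qed.

Lemma positive_functionals_cone : convex_cone (positive_functionals X).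
Proof.
split.
  split; first by move=> c f g; rewrite -[LHS]/0 -[RHS]/(c * 0 + 0) mulr0 addr0.
  by move=> f _; exact: lexx.
move=> c d u v c0 d0 [lu pu] [lv pv]; split.
  move=> k f g; have [u' uE] := positive_linear u (conj lu pu).
  have [v' vE] := positive_linear v (conj lv pv).
  rewrite -[LHS]/(c * u (k *: f + g) + d * v (k *: f + g)).
  rewrite -[RHS]/(k * (c * u f + d * v f) + (c * u g + d * v g)).
  rewrite uE vE !linearP/=.
  rewrite !mulrDr [c * (k * _)]mulrCA [d * (k * _)]mulrCA.
  by rewrite addrACA.
by move=> f f0; apply: addr_ge0; apply: mulr_ge0; rewrite ?pu ?pv.
Qed.

End PositiveFunctionals.

(** * Riemann-Stieltjes integrals *)

Section RiemannStieltjes.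
Context {R : realType} (a b : R).
Local Notation C := (continuousType (set_type `[a, b]) R).
Implicit Types (f : C) (alpha beta : R -> R) (K : set R).

Lemma RS_integral_comb f alpha beta (c d I J : R) :
  is_RS_integral f alpha I -> is_RS_integral f beta J ->
  is_RS_integral f (c *: alpha + d *: beta) (c * I + d * J).
Proof.
move=> fI fJ e e0.
(* [|k| + 1] instead of [|k|] because a coefficient may be zero. *)
have scaled (k : R) : 0 < e / 2 / (`|k| + 1).
  by apply: divr_gt0; [exact: divr_gt0|rewrite ltr_wpDl].
have scaledM (k x : R) : `|x| < e / 2 / (`|k| + 1) -> `|k * x| < e / 2.
  move=> xk; rewrite normrM.
  have [->|k0] := eqVneq k 0; first by rewrite normr0 mul0r divr_gt0.
  rewrite (@lt_trans _ _ (`|k| * (e / 2 / (`|k| + 1))))//.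
    by rewrite ltr_pM2l// normr_gt0.
  have k1 : 0 < `|k| + 1 by rewrite ltr_wpDl.
  rewrite mulrCA gtr_pMr; last by rewrite divr_gt0.
  by rewrite ltr_pdivrMr// mul1r ltrDl.
have [d1 d10 d1P] := fI _ (scaled c); have [d2 d20 d2P] := fJ _ (scaled d).
exists (Num.min d1 d2); first by rewrite lt_min d10.
move=> s t abs ts mesh.
have -> : RS_sum f (c *: alpha + d *: beta) s t - (c * I + d * J) =
    c * (RS_sum f alpha s t - I) + d * (RS_sum f beta s t - J).
  rewrite /RS_sum !mulrBr addrACA -opprD; congr (_ - _).
  rewrite !mulr_sumr -big_split/=; apply: eq_bigr => i _.
  rewrite -[(c *: alpha + d *: beta) _]/(c * alpha _ + d * beta _).
  rewrite -[X in _ * (_ - X)]/(c * alpha _ + d * beta _).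
  ring.
rewrite (splitr e) (le_lt_trans (ler_normD _ _))// ltrD//; apply: scaledM.
  by apply: d1P => // i /mesh; rewrite lt_min => /andP[].
by apply: d2P => // i /mesh; rewrite lt_min => /andP[].
Qed.

Lemma RS_integral0 f : is_RS_integral f (fun=> 0) 0.
Proof.
move=> e e0; exists 1 => // s t _ _ _.
by rewrite /RS_sum big1 ?subrr ?normr0// => i _; rewrite mulr0.
Qed.

(** A combination of the functionals is represented by the same combination of
the monotone functions; nonnegative coefficients keep it monotone. *)
Lemma RS_cone K : convex_cone (RS_functionals_constant_in_compl a b K).
Proof.
have [pos0 posD] := @positive_functionals_cone R `[a, b].
split.
  split=> //; exists (fun=> 0); split => //.
  - by split=> // t _; exact: cvg_cst.
  - by move=> f; exact: RS_integral0.
move=> c d L M c0 d0.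
move=> [posL [al [[al0 ral] mal iL cal]]] [posM [be [[be0 rbe] mbe iM cbe]]].
split; first exact: posD.
exists (c *: al + d *: be); split.
- split; first by rewrite -[LHS]/(c * al a + d * be a) al0 be0 !mulr0 addr0.
  by move=> t tab; apply: cvgD; apply: cvgMl_tmp; [exact: ral|exact: rbe].
- move=> x y xab yab xy.
  by apply: lerD; apply: ler_wpM2l => //; [exact: mal|exact: mbe].
- by move=> f; exact: RS_integral_comb.
- move=> I IK x y xI yI.
  rewrite -[LHS]/(c * al x + d * be x) -[RHS]/(c * al y + d * be y).
  by rewrite (cal I IK x y)// (cbe I IK x y).
Qed.

Lemma fine_partition (d : R) : a < b -> 0 < d ->
  exists2 s, itv_partition a b s & forall i, (i < size s)%N ->
    nth b (a :: s) i.+1 - nth b (a :: s) i < d.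
Proof.
move=> ltab d0.
have [n] : exists n, b - a < n%:R * (d / 2).
  exists (Num.truncn ((b - a) / (d / 2))).+1.
  by rewrite -ltr_pdivrMr ?divr_gt0// truncnS_gt.
(* Cut off intervals of length [d / 2] from the left until less than [d] is
   left; the last piece then has positive length. *)
elim: n a ltab => [|n IH] x xb; first by rewrite mul0r subr_lt0 ltNge ltW.
have [bx _|bx] := ltP (b - x) d.
  by exists [:: b]; [exact: itv_partition1|case].
rewrite -natr1 mulrDl mul1r => bxn.
have [|| s [ps ls] sP] := IH (x + d / 2); [lra|lra|].
exists (x + d / 2 :: s); first by split; rewrite //= ltrDl divr_gt0.
case=> [_|i /= isz]; last exact: (sP i).
by rewrite /= addrC addKr gtr_pMr// invf_lt1 ?ltr1n.
Qed.

(** The mass [d alpha] is carried by [K].  In a Riemann-Stieltjes sum over a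
fine partition, an interval disjoint from [K] contributes nothing, since [alpha]
is constant on it; on an interval that meets [K] the value of [h] is within [e']
of a zero of [h].  The sum is thus at most [e'] times the total variation. *)
Lemma RS_integral_vanish K (h : continuousType R R) alpha (I : R) : a < b ->
  K `<=` `[a, b] -> monotone_itv a b alpha -> constant_in_compl a b K alpha ->
  (forall x, K x -> h x = 0) ->
  is_RS_integral (restriction `[a, b] h) alpha I -> I = 0.
Proof.
move=> ltab Kab mal cal hK hI.
pose V := alpha b - alpha a.
have V0 : 0 <= V.
  by rewrite subr_ge0 mal ?in_itv/= ?lexx ?(ltW ltab).
apply/eqP; rewrite -normr_le0; apply/ler_addgt0Pr => e e0; rewrite add0r.
have V1 : 0 < V + 1 by rewrite ltr_wpDl.
pose e' := e / (V + 1); have e'0 : 0 < e' by rewrite divr_gt0.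
have [d d0 dP] := hI _ e'0.
have [d' d'0 d'P] := heine_cantor `[a, b] h e' (@segment_compact R a b) e'0.
have [|s abs mesh] := fine_partition (Num.min d d') ltab.
  by rewrite lt_min d0.
have sab i : (i < (size s).+1)%N -> nth b (a :: s) i \in `[a, b].
  by move=> isz; rewrite in_itv/= itv_partition_nth_ge ?itv_partition_nth_le.
have smono i : (i < size s)%N -> nth b (a :: s) i <= nth b (a :: s) i.+1.
  exact: (@nondecreasing_fun_itv_partition _ _ a b id).
(* The tags are the left endpoints. *)
have /choice[t tP] : forall i, exists t : `[a, b]%classic, (i < size s)%N ->
    \val t = nth b (a :: s) i.
  move=> i; have [isz|] := ltnP i (size s); last first.
    have aab : a \in `[a, b]%classic by rewrite inE/= in_itv/= lexx ltW.
    by exists (SigSub aab).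
  have xab : nth b (a :: s) i \in `[a, b]%classic by rewrite inE; exact/sab/ltnW.
  by exists (SigSub xab).
have sumI : `|RS_sum (restriction `[a, b] h) alpha s t - I| < e'.
  apply: dP => // i isz; first by rewrite tP// lexx smono.
  by have := mesh i isz; rewrite lt_min => /andP[].
have sum0 : `|RS_sum (restriction `[a, b] h) alpha s t| <= e' * V.
  have -> : e' * V = \sum_(0 <= i < size s)
      e' * (alpha (nth b (a :: s) i.+1) - alpha (nth b (a :: s) i)).
    rewrite -mulr_sumr telescope_sumr//; congr (_ * (alpha _ - _)).
    by rewrite (itv_partition_nth_size b abs).
  rewrite (le_trans (ler_norm_sum _ _ _))//; apply: ler_sum_nat => i /andP[_ isz].
  rewrite normrM [X in _ * X]ger0_norm ?subr_ge0; last first.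
    by apply: mal; [apply/sab/ltnW|exact: sab|exact: smono].
  have [[x Kx xi]|nK] :=
    pselect (exists2 x, K x & nth b (a :: s) i <= x <= nth b (a :: s) i.+1).
    apply: ler_wpM2r.
      by rewrite subr_ge0; apply: mal; [apply/sab/ltnW|exact: sab|exact: smono].
    rewrite -[restriction _ _ _]/(h (\val (t i))) tP//.
    rewrite -[X in `|X|]subr0 -(hK x Kx) ltW//; apply: d'P; first exact/sab/ltnW.
      exact: Kab.
    have := mesh i isz; rewrite lt_min => /andP[_]; apply: le_lt_trans.
    by case/andP: xi => x1 x2; rewrite distrC ger0_norm ?subr_ge0// lerD2r.
  rewrite (cal `[nth b (a :: s) i, nth b (a :: s) i.+1] _
    (nth b (a :: s) i.+1) (nth b (a :: s) i)) ?subrr ?mulr0//.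
  - move=> x /=; rewrite in_itv/= => xi; split; last by move=> Kx; apply: nK; exists x.
    rewrite /= in_itv/=; case/andP: xi => x1 x2.
    have := sab i (ltnW isz); have := sab i.+1 isz; rewrite !in_itv/=.
    by move=> /andP[_ h1] /andP[h2 _]; rewrite (le_trans h2)//= (le_trans x2).
  - by rewrite in_itv/= lexx smono.
  - by rewrite in_itv/= lexx smono.
have -> : e = e' * V + e' by rewrite /e' -[X in _ + X]mulr1 -mulrDr divfK// gt_eqF.
rewrite -[X in `|X|](subKr (RS_sum (restriction `[a, b] h) alpha s t)).
by rewrite (le_trans (ler_normB _ _))// lerD// ltW.
Qed.

End RiemannStieltjes.

(** * Continuous approximations of indicators of half-lines *)

Section Ramps.
Context {R : realType}.
Implicit Types (a s t x : R) (n m : nat).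

Fact ramp_subproof t n :
  continuous (fun x => Num.max 0 (Num.min 1 (1 - n%:R * (x - t)))).
Proof.
move=> x; pose g : R -> R^o := fun x => 1 - n%:R * (x - t).
apply: (@continuous_max R R (fun=> 0) ((fun=> 1) \min g)); first exact: cvg_cst.
apply: (@continuous_min R R (fun=> 1) g); first exact: cvg_cst.
apply: cvgB; first exact: cvg_cst.
by apply: cvgMl_tmp; apply: cvgB; [exact: cvg_id|exact: cvg_cst].
Qed.

Definition ramp t n : continuousType R R := mkcts (ramp_subproof t n).

(** As [n] grows, [step a t n] decreases to the indicator of the half-line up to
[t], except for [t <= a], where it is [0]: this encodes the normalization
[alpha a = 0], which counts a point mass at [a] in the first increment. *)
Definition step a t n : continuousType R R := if t <= a then 0 else ramp t n.

Lemma rampE t n x : ramp t n x = Num.max 0 (Num.min 1 (1 - n%:R * (x - t))).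
Proof. by []. Qed.

Lemma stepE a t n x : step a t n x = if t <= a then 0 else ramp t n x.
Proof. by rewrite /step; case: ifP. Qed.

Lemma ramp_ge0 t n x : 0 <= ramp t n x.
Proof. by rewrite rampE le_max lexx. Qed.

Lemma step_ge0 a t n x : 0 <= step a t n x.
Proof. by rewrite stepE; case: ifP => // _; exact: ramp_ge0. Qed.

Lemma step_left a t n x : a < t -> x <= t -> step a t n x = 1.
Proof.
move=> at_ xt; rewrite stepE leNgt at_/= rampE min_l ?max_r//.
by rewrite lerDl oppr_ge0 mulr_ge0_le0 ?subr_le0.
Qed.

Lemma step_right a t n x : 1 <= n%:R * (x - t) -> step a t n x = 0.
Proof.
move=> xt; rewrite stepE; case: ifP => // _.
by rewrite rampE max_l// ge_min subr_le0 xt orbT.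
Qed.

Lemma step_slope a t n m x : (n <= m)%N -> step a t m x <= step a t n x.
Proof.
move=> nm; have [xt|tx] := leP x t.
  have [ta|at_] := leP t a; first by rewrite !stepE ta.
  by rewrite !step_left.
rewrite !stepE; case: ifP => // _; rewrite !rampE.
apply: le_max2 => //; apply: le_min2 => //.
by rewrite lerD2l lerN2 ler_wpM2r ?ler_nat// subr_ge0 ltW.
Qed.

Lemma step_mono a s t n x : s <= t -> step a s n x <= step a t n x.
Proof.
move=> st; have [sa|sa] := leP s a.
  by rewrite stepE sa step_ge0.
rewrite !stepE !ifN -?ltNge//; last exact: lt_le_trans st.
rewrite !rampE.
apply: le_max2 => //; apply: le_min2 => //.
by rewrite lerD2l lerN2 ler_wpM2l// lerB.
Qed.

(** Shifting a ramp of slope [n] by [s - t] raises it by at most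
[n * (s - t)]; right-continuity of [distr] rests on this bound.  At [t = a],
where [M] may have a point mass, both may fail. *)
Lemma step_lipschitz a s t n x : a < t -> t <= s ->
  step a s n x <= step a t n x + n%:R * (s - t).
Proof.
move=> at_ ts; rewrite !stepE !ifN -?ltNge//; last exact: lt_le_trans ts.
rewrite !rampE.
have nst : 0 <= n%:R * (s - t) by rewrite mulr_ge0// subr_ge0.
have -> : 1 - n%:R * (x - s) = 1 - n%:R * (x - t) + n%:R * (s - t) by ring.
move: nst; set u := n%:R * (s - t); set v := 1 - _ => u0.
rewrite /Num.max /Num.min; do 4?case: ifPn; lra.
Qed.

End Ramps.

(** * Riesz representation of functionals on a closed subset of an interval *)

Section Riesz.
Context {R : realType} (K : set R) (a b : R).
Context (ltab : a < b) (cK : closed K) (Kab : K `<=` `[a, b]).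
Context (M : continuousType (set_type K) R -> R).
Context (posM : positive_functionals K M).

Local Notation res := (restriction K).
Local Notation one := (res (cts_const 1)).

Definition mass t n : R := M (res (step a t n)).

(** The distribution function of the measure that represents [M]. *)
Definition distr t : R := inf (range (mass t)).

Lemma mass_ge0 t n : 0 <= mass t n.
Proof. by apply: posM.2 => x; exact: step_ge0. Qed.

Lemma mass_lbound t : has_lbound (range (mass t)).
Proof. by exists 0 => _ [n _ <-]; exact: mass_ge0. Qed.

Lemma mass_slope t n m : (n <= m)%N -> mass t m <= mass t n.
Proof. by move=> nm; apply: positive_le => // x; exact: step_slope. Qed.

Lemma mass_cvg t : mass t n @[n --> \oo] --> distr t.
Proof.
by apply: nonincreasing_cvgn; [exact: mass_slope|exact: mass_lbound].
Qed.

Lemma distr_le t n : distr t <= mass t n.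
Proof. by apply: ge_inf; [exact: mass_lbound|exists n]. Qed.

Lemma distr_mono s t : s <= t -> distr s <= distr t.
Proof.
move=> st; apply: lb_le_inf; first by exists (mass t 0), 0.
move=> _ [n _ <-]; apply: le_trans (distr_le s n) _.
by apply: positive_le => // x; exact: step_mono.
Qed.

(** Choose [n] with [mass t n] close to [distr t]; with this [n] fixed,
[distr s <= mass s n] and [mass s n] is Lipschitz in [s]. *)
Lemma distr_right_continuous t : a < t -> distr x @[x --> t^'+] --> distr t.
Proof.
move=> at_; apply/cvgrPdist_le => e e0.
have M1 : 0 <= M one := positive_one M posM.
have [_ [n _ <-]] : exists2 y, range (mass t) y & y < distr t + e / 2.
  apply: inf_adherent; rewrite ?divr_gt0//.
  by split; [exists (mass t 0), 0|exact: mass_lbound].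
move=> Bn; have c0 : 0 < n%:R * M one + 1 by rewrite ltr_wpDl// mulr_ge0.
near=> s.
have ts : t < s by near: s; exact: nbhs_right_gt.
rewrite distrC ger0_norm ?subr_ge0 ?distr_mono ?(ltW ts)// lerBlDl.
apply: le_trans (distr_le s n) _.
have : mass s n <= mass t n + n%:R * (s - t) * M one.
  have [L LE] := positive_linear _ posM.
  rewrite /mass LE -linearZ -linearD -LE -!restrictionZ -restrictionD.
  apply: positive_le => // x.
  apply: le_trans (step_lipschitz a s t n (\val x) at_ (ltW ts)) _.
  rewrite -[leRHS]/(step a t n (\val x) + n%:R * (s - t) * 1).
  by rewrite mulr1.
move=> /le_trans; apply.
have : (s - t) * (n%:R * M one + 1) <= e / 2.
  rewrite -ler_pdivlMr// lerBlDl ltW//; near: s; apply: nbhs_right_lt.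
  by rewrite ltrDl !divr_gt0.
have : 0 <= s - t by rewrite subr_ge0 ltW.
move: Bn; set u := mass t n; set v := M one; set k := n%:R.
nra.
Unshelve. all: by end_near. Qed.

Lemma distr_left : distr a = 0.
Proof.
have massa n : mass a n = 0.
  rewrite /mass /step lexx; have [L ->] := positive_linear _ posM.
  by rewrite -(linear0 L); congr (L _); exact/continuousEP.
apply/eqP; rewrite eq_le -{1}(massa 0) distr_le/=.
by apply: lb_le_inf; [exists (mass a 0), 0|move=> _ [n _ <-]; exact: mass_ge0].
Qed.

(** If [x <= y] lie in an interval that misses [K], then [K] even misses some
neighbourhood of [y], as [K] is closed.  Ramps steep enough to descend within
this neighbourhood agree on [K], whether they start at [x] or at [y]. *)
Lemma distr_constant : constant_in_compl a b K distr.
Proof.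
move=> I IK.
suff le x y : x \in I -> y \in I -> x <= y -> distr y <= distr x.
  move=> x y xI yI; have [xy|/ltW yx] := leP x y; apply/le_anti.
    by rewrite (distr_mono _ _ xy) le.
  by rewrite (distr_mono _ _ yx) le.
move=> xI yI xy; apply: lb_le_inf; first by exists (mass x 0), 0.
move=> _ [n _ <-].
have [yab nKy] := IK _ yI.
have [xab nKx] := IK _ xI.
have [d /= d0 dK] : nbhs y (~` K).
  by apply: open_nbhs_nbhs; split => //; exact: closed_openC.
(* Slope [m] brings the ramp from [y] down to [0] by [y + d]. *)
pose m := maxn n (Num.truncn d^-1).+1.
suff myx : mass y m = mass x m.
  apply: le_trans (distr_le y m) _; rewrite myx.
  exact/mass_slope/leq_maxl.
rewrite /mass; congr (M _); apply: restriction_eq => z Kz.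
have nI : z \notin I by apply/negP => zI; have [_ /(_ Kz)] := IK _ zI.
have zab := Kab _ Kz; rewrite /= in_itv/= in zab; case/andP: zab => az zb.
have [zx|xz] := ltP z x.
  have ax : a < x := le_lt_trans az zx.
  rewrite (step_left a x _ z ax (ltW zx)).
  by rewrite (step_left a y _ z (lt_le_trans ax xy) (le_trans (ltW zx) xy)).
have yz : y < z.
  rewrite ltNge; apply/negP => zy; move/negP: nI; apply.
  by apply: (interval_is_interval xI yI); rewrite xz.
have dyz : d <= z - y.
  rewrite leNgt; apply/negP => zyd; apply: (dK z) => //.
  by rewrite /ball/= distrC gtr0_norm ?subr_gt0.
have my : 1 <= m%:R * (z - y).
  have : d^-1 <= m%:R.
    by rewrite (le_trans (ltW (truncnS_gt _)))// ler_nat leq_maxr.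
  rewrite -ler_pdivrMr ?subr_gt0// mul1r; apply: le_trans.
  by rewrite lef_pV2 ?posrE ?subr_gt0.
rewrite !step_right//; apply: le_trans my _.
by rewrite ler_wpM2l// lerB.
Qed.

(** The differences of consecutive steps form a partition of unity on [[a, b]]
whose [i]-th member vanishes outside the [i]-th interval prolonged by [d] to the
right; where it does not vanish, [h] is within [e] of its value at the tag. *)
Lemma step_sum_close h (s : seq R) (t : nat -> `[a, b]%classic) n (d e : R) :
  0 <= e -> itv_partition a b s ->
  (forall i, (i < size s)%N ->
     nth b (a :: s) i <= \val (t i) <= nth b (a :: s) i.+1) ->
  (forall i, (i < size s)%N -> nth b (a :: s) i.+1 - nth b (a :: s) i < d) ->
  1 <= n%:R * d ->
  (forall x y, `[a, b]%classic x -> `[a, b]%classic y -> `|x - y| < d + d ->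
     `|h x - h y| <= e) ->
  forall x, `[a, b]%classic x ->
  `|h x - \sum_(0 <= i < size s) h (\val (t i)) *
     (step a (nth b (a :: s) i.+1) n x - step a (nth b (a :: s) i) n x)| <= e.
Proof.
move=> e0 abs ts mesh nd hd x xab.
have [ax xb] : a <= x /\ x <= b by move: xab; rewrite /= in_itv/= => /andP.
pose S i := step a (nth b (a :: s) i) n x.
have Stot : \sum_(0 <= i < size s) (S i.+1 - S i) = 1.
  rewrite telescope_sumr// /S (itv_partition_nth_size b abs).
  by rewrite step_left// stepE lexx subr0.
have -> : h x - \sum_(0 <= i < size s) h (\val (t i)) * (S i.+1 - S i) =
    \sum_(0 <= i < size s) (h x - h (\val (t i))) * (S i.+1 - S i).
  rewrite -[X in X - _]mulr1 -Stot mulr_sumr -sumrB.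
  by apply: eq_bigr => i _; rewrite mulrBl.
rewrite -[leRHS]mulr1 -Stot mulr_sumr (le_trans (ler_norm_sum _ _ _))//.
apply: ler_sum_nat => i /andP[_ isz].
have smono : nth b (a :: s) i <= nth b (a :: s) i.+1.
  exact: (@nondecreasing_fun_itv_partition _ _ a b id).
have S0 : 0 <= S i.+1 - S i by rewrite subr_ge0; exact: step_mono.
rewrite normrM (ger0_norm S0).
have [xl|lx] := ltP x (nth b (a :: s) i).
  have al : a < nth b (a :: s) i := le_lt_trans ax xl.
  rewrite /S (step_left _ _ _ _ al (ltW xl)).
  rewrite (step_left _ _ _ _ (lt_le_trans al smono)) ?subrr ?mulr0//.
  exact: le_trans (ltW xl) smono.
have [xr|rx] := ltP x (nth b (a :: s) i.+1 + d).
  apply: ler_wpM2r => //; apply: hd => //; first exact: set_valP.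
  have := ts i isz; have := mesh i isz; move: smono lx xr.
  set l := nth b (a :: s) i; set r := nth b (a :: s) i.+1; set y := \val _.
  by move=> *; rewrite ltr_norml; lra.
rewrite /S !step_right ?subrr ?mulr0//; apply: le_trans nd _; apply: ler_wpM2l => //.
  by rewrite lerBrDl (le_trans _ rx)// lerD2r.
by rewrite lerBrDl.
Qed.

(** The distance between [M h] and [M] of the weighted sum of steps is bounded
uniformly in [n]; the bound survives the limit [n -> oo], in which the latter
becomes the Riemann-Stieltjes sum.  This avoids choosing a slope for each
partition point. *)
Lemma distr_RS_integral h :
  is_RS_integral (restriction `[a, b] h) distr (M (res h)).
Proof.
move=> e e0; have M0 : 0 <= M one := positive_one M posM.
have M1 : 0 < M one + 1 by rewrite ltr_wpDl.
pose e' := e / (M one + 1); have e'0 : 0 < e' by rewrite divr_gt0.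
have [d d0 hd] := heine_cantor `[a, b] h e' (@segment_compact R a b) e'0.
(* Half of [d] for the mesh, half for the width of the ramps. *)
exists (d / 2); first by rewrite divr_gt0.
move=> s t abs ts mesh.
pose F n : continuousType R R := \sum_(0 <= i < size s) h (\val (t i)) *:
  (step a (nth b (a :: s) i.+1) n - step a (nth b (a :: s) i) n).
have [L LE] := positive_linear M posM.
have MF n : M (res (F n)) = \sum_(0 <= i < size s) h (\val (t i)) *
    (mass (nth b (a :: s) i.+1) n - mass (nth b (a :: s) i) n).
  have -> : res (F n) = \sum_(0 <= i < size s) h (\val (t i)) *:
    (res (step a (nth b (a :: s) i.+1) n) - res (step a (nth b (a :: s) i) n)).
    apply/continuousEP => x; rewrite cts_sumE.
    by rewrite -[LHS]/(F n (\val x)) /F cts_sumE.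
  by rewrite /mass LE linear_sum; apply: eq_bigr => i _; rewrite linearZ linearB.
have Flim : M (res (F n)) @[n --> \oo] --> RS_sum (restriction `[a, b] h) distr s t.
  under eq_fun do rewrite MF.
  apply: cvg_big => [|i _]; first exact: add_continuous.
  apply: cvgMl_tmp; apply: cvgB; exact: mass_cvg.
have Fclose : \forall n \near \oo, `|M (res h) - M (res (F n))| <= e' * M one.
  exists (Num.truncn (d / 2)^-1).+1 => // n /= nd.
  rewrite LE -linearB -LE; apply: positive_norm_le => // x.
  have xab : `[a, b]%classic (\val x) by apply: Kab; exact: set_valP.
  have := step_sum_close h s t n (d / 2) e' (ltW e'0) abs ts mesh.
  rewrite -[X in `|X|]/(h (\val x) - F n (\val x)) /F cts_sumE; apply => //.
    rewrite -ler_pdivrMr ?divr_gt0// mul1r.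
    by rewrite (le_trans (ltW (truncnS_gt _)))// ler_nat.
  by move=> y z yab zab; rewrite -splitr => yz; apply/ltW/hd.
rewrite distrC.
apply: (@le_lt_trans _ _ (e' * M one)).
  have : `|M (res h) - M (res (F n))| @[n --> \oo] -->
      `|M (res h) - RS_sum (restriction `[a, b] h) distr s t|.
    by apply: cvg_norm; apply: cvgB => //; exact: cvg_cst.
  by move=> /cvgr_to_le; apply.
by rewrite /e' mulrAC ltr_pdivrMr// ltr_pM2l// ltrDl.
Qed.

End Riesz.

(** * The isomorphism of cones *)

Theorem theorem3p2 (R : realType) (K : set R) (a b : R)
    (compact_K : compact K) (lt_ab : a < b) (sub_K_ab : K `<=` `[a, b]) :
  isomorphic_normed_cones
    (@dual_norm R `[a, b]) (@dual_norm R K)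
    (RS_functionals_constant_in_compl a b K) (positive_functionals K).
Proof.
have cab := @segment_compact R a b.
have /choice[extK extKP] : forall g : continuousType (set_type K) R,
    exists h, restriction K h = g by move=> g; exact: restriction_surj.
have vanish L h1 h2 : RS_functionals_constant_in_compl a b K L ->
    restriction K h1 = restriction K h2 ->
    L (restriction `[a, b] h1) = L (restriction `[a, b] h2).
  move=> [posL [al [_ mal iL cal]]] h12; apply/eqP; rewrite -subr_eq0; apply/eqP.
  have [L' LE] := positive_linear L posL.
  rewrite LE -linearB -LE.
  have -> : restriction `[a, b] h1 - restriction `[a, b] h2 =
            restriction `[a, b] (h1 - h2) by exact/continuousEP.
  apply: (RS_integral_vanish a b K (h1 - h2) al) => // x Kx.
  by rewrite -[LHS]/(h1 x - h2 x) (eq_restriction h12 Kx) subrr.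
split; [exact: RS_cone|exact: positive_functionals_cone|].
pose T (L : continuousType (set_type `[a, b]) R -> R) :
    continuousType (set_type K) R -> R := fun g => L (restriction `[a, b] (extK g)).
have TE L h : RS_functionals_constant_in_compl a b K L ->
    T L (restriction K h) = L (restriction `[a, b] h).
  by move=> AL; apply: vanish => //; rewrite extKP.
have posT L : RS_functionals_constant_in_compl a b K L ->
    positive_functionals K (T L).
  move=> AL; have [L' LE] := positive_linear L AL.1; split.
    move=> c f g; rewrite -[RHS]/(c * T L f + T L g).
    rewrite -{1}(extKP f) -{1}(extKP g) -restrictionZ -restrictionD TE//.
    by rewrite restrictionD restrictionZ LE linearP.
  (* An extension of a nonnegative [g] may take negative values off [K]; its
     absolute value is an extension that does not. *)
  move=> g g0.
  have cabs : continuous (fun x => `|extK g x|).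
    by move=> x; apply: cvg_norm; exact: cts_fun.
  rewrite -(extKP g) (_ : restriction K (extK g) = restriction K (mkcts cabs)).
    by rewrite TE//; apply: AL.1.2 => x; exact: normr_ge0.
  apply/continuousEP => x; rewrite -[RHS]/(`|restriction K (extK g) x|).
  by rewrite extKP ger0_norm.
exists T; split.
- split.
  + by move=> L /posT.
  + move=> L1 L2 /set_mem A1 /set_mem A2 T12; apply/funext => f.
    have [h <-] := restriction_surj `[a, b] f cab.
    by rewrite -!TE// T12.
  + move=> M posM.
    have /choice[ext extP] : forall f : continuousType (set_type `[a, b]) R,
        exists h, restriction `[a, b] h = f.
      by move=> f; exact: restriction_surj.
    pose L f := M (restriction K (ext f)).
    have LE h : L (restriction `[a, b] h) = M (restriction K h).
      congr (M _); apply: restriction_eq => x /sub_K_ab.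
      exact/eq_restriction/extP.
    have AL : RS_functionals_constant_in_compl a b K L.
      split.
        have [M' ME] := positive_linear M posM; split.
          move=> c f g; rewrite -{1}(extP f) -{1}(extP g).
          rewrite -restrictionZ -restrictionD LE restrictionD restrictionZ.
          by rewrite ME linearP -ME.
        move=> f f0; apply: posM.2 => x.
        have xab : `[a, b]%classic (\val x) by apply: sub_K_ab; exact: set_valP.
        by have := f0 (SigSub (mem_set xab)); rewrite -{1}(extP f).
      exists (distr K a M); split.
      * split; first exact: distr_left.
        by move=> t /andP[at_ _]; exact: distr_right_continuous.
      * by move=> x y _ _; exact: distr_mono.
      * by move=> f; rewrite -{1}(extP f); exact: distr_RS_integral.
      * by apply: distr_constant => //; exact: compact_closed.
    exists L => //; apply/funext => g.
    by rewrite -(extKP g) TE.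
- by [].
- move=> L AL.
  by rewrite !dual_norm_positive ?TE//; [exact: AL.1|exact: posT].
Qed.
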